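(* Let $m\ge 1$ and let $\Delta\in\mathbb{Z}[t_1^{\pm1},\dots,t_m^{\pm1}]$ satisfy $\Delta(1,\dots,1)=1$ and $\Delta(t_1,\dots,t_m)=\Delta(t_1^{-1},\dots,t_m^{-1})$. Write $$\Delta(t_1,\dots,t_m)=\sum_{\alpha\in\mathbb{Z}^m}c_\alpha(t^\alpha+t^{-\alpha})+1-\sum_{\alpha\in\mathbb{Z}^m}2c_\alpha,$$ where $c_\alpha\in\mathbb{Z}$, $c_\alpha=0$ for all but finitely many $\alpha$, and $c_{(0,\dots,0)}=0$. Let $\alpha_1,\dots,\alpha_r$ be the distinct $\alpha$ with $c_\alpha\neq0$. Let $p:\{0,\dots,l\}\to\mathbb{Z}^m$ (with $l\ge1$) be a map such that: (1) $p(0)=(0,\dots,0)$; (2) $|p(t)-p(t-1)|=1$ for all $t=1,\dots,l$, i.e. $p(t)=p(t-1)+\epsilon_t e_{s_t}$ for unique $\epsilon_t\in\{-1,+1\}$ and $s_t\in\{1,\dots,m\}$, where $e_i$ is the $i$-th unit vector of $\mathbb{Z}^m$; (3) for each $i=1,\dots,r$ there exists $t_i\in\{1,\dots,l\}$ with $p(t_i)=\alpha_i$; fix one such index $t_i$ for each $i$. Define $w_{t_i}:=c_{p(t_i)}=c_{\alpha_i}$ for $i=1,\dots,r$, $w_j:=0$ for all other $j\in\{1,\dots,l\}$, and $v_i:=\sum_{j=i}^{l}w_j$ for $i=1,\dots,l$. Let $B:=B_l(v_1,\dots,v_l,\epsilon_2,\dots,\epsilon_l)$ be the $2l\times 2l$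 integer matrix defined in the context, and let $$\tilde T:=\mathrm{diag}(t_{s_1},t_{s_1},t_{s_2},t_{s_2},\dots,t_{s_l},t_{s_l})$$ (here $t_{s_k}$ denotes the variable with index $s_k$). Let $P$ be a $2l\times2l$ permutation matrix which permutes the $l$ consecutive pairs of coordinates (preserving the order inside each pair) and satisfies $$P\tilde TP^{-1}=\mathrm{diag}(\underbrace{t_1,\dots,t_1}_{n_1},\dots,\underbrace{t_m,\dots,t_m}_{n_m})$$ for some $n_1,\dots,n_m$ (necessarily $n_i=2\cdot\#\{k\in\{1,\dots,l\}: s_k=i\}$). Then $A:=PBP^{-1}$ is a boundary link Seifert matrix of size $(n_1,\dots,n_m)$, and $\Delta(A)=\Delta$.
   Context: Boundary link Seifert matrix: a block matrix $A=(A_{ij})_{i,j=1,\dots,m}$, where $A_{ij}$ is an $n_i\times n_j$ matrix over $\mathbb{Z}$, such that $A_{ij}=A_{ji}^t$ for $i\ne j$ and $\det(A_{ii}-A_{ii}^t)=1$ for all $i$ (so each $n_i$ is even; if $n_i=0$ the determinant of the empty matrix is $1$). Its size is $(n_1,\dots,n_m)$. Alexander polynomial of $A$: with $T:=\mathrm{diag}(t_1,\dots,t_1,\dots,t_m,\dots,t_m)$, where $t_i$ is repeated $n_i$ times, $$\Delta(A):=\det(T)^{-1/2}\det(TA-A^t)\in\mathbb{Z}[t_1^{\pm1},\dots,t_m^{\pm1}],\qquad \det(T)^{-1/2}=\prod_{i=1}^m t_i^{-n_i/2}.$$ Multi-index notation: $t^\alpha=t_1^{a_1}\cdots t_m^{a_m}$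 for $\alpha=(a_1,\dots,a_m)\in\mathbb{Z}^m$. The matrices $B_i$: for $v_1,\dots,v_l\in\mathbb{Z}$ and $\epsilon_2,\dots,\epsilon_l\in\{-1,+1\}$ put $z_i:=\frac12(1+\epsilon_i)$. Define $2i\times2i$ matrices $B_i=B_i(v_1,\dots,v_i,\epsilon_2,\dots,\epsilon_i)$ inductively by $$B_1:=\begin{pmatrix}v_1&0\\-1&1\end{pmatrix},\qquad B_i:=\begin{pmatrix}B_{i-1}&C_i\\ C_i^t&D_i\end{pmatrix}\quad(i\ge2),\qquad D_i:=\begin{pmatrix}v_i&z_i\\1-z_i&1\end{pmatrix},$$ where $C_i$ is the $(2i-2)\times2$ matrix obtained by stacking vertically $i-1$ blocks of size $2\times2$: the top block is $\begin{pmatrix}v_i&0\\0&1\end{pmatrix}$ and each of the remaining $i-2$ blocks is $\begin{pmatrix}v_i&1\\0&1\end{pmatrix}$.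
   Formalization: Δ(A)=Δ is proved only when ε_1=+1, since B does not depend on ε_1 and the claim fails otherwise (m=1, p=(0,-1,-2), Δ=t^2+t^{-2}-1 gives Δ(A)=1); that A is a boundary link Seifert matrix is proved for both signs. The remark on n_i is not part of the conclusion. *)

(* Defs.v *)
From HB Require Import structures.
From mathcomp Require Import all_boot all_order all_fingroup all_algebra.
From mathcomp Require Export finmap.
From mathcomp.multinomials Require Export monalg.

Set Implicit Arguments.
Unset Strict Implicit.
Unset Printing Implicit Defensive.

Import Order.TTheory GRing.Theory Num.Theory.

Local Open Scope fset_scope.
Local Open Scope ring_scope.

(* Z[t_1^+-1, ..., t_m^+-1], as the group ring of Z^m over Z: [f@_a] is the   *)
(* coefficient of t^a.  The ring structure of monalg is unavailable because   *)
(* its monomial types must have no nontrivial units, so the product is        *)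
(* defined here.                                                              *)
Definition laurent (m : nat) : Type :=
  {malg int['rV[int]_m]}.

HB.instance Definition _ (m : nat) :=
  GRing.Zmodule.on (laurent m).

(* The monomial t^a, for a multi-index a in Z^m. *)
Definition lmon (m : nat) (a : 'rV[int]_m) : laurent m :=
  << (1 : int) *g a >>.

Section LaurentRing.
Variable m : nat.
Implicit Types (f g h : laurent m) (a b : 'rV[int]_m) (x y : int).

Definition lterm x a : laurent m := << x *g a >>.

Definition lmul f g : laurent m :=
  \sum_(a <- msupp f) \sum_(b <- msupp g) lterm (f@_a * g@_b) (a + b).

Lemma lterm0 a : lterm 0 a = 0.
Proof. exact: monalgU0. Qed.

Lemma ltermD a x y : lterm (x + y) a = lterm x a + lterm y a.
Proof. exact: monalgUD. Qed.

Lemma lcoeffD f g a : (f + g)@_a = f@_a + g@_a.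
Proof. exact: mcoeffD. Qed.

Lemma lsuppD f g : msupp (f + g) `<=` msupp f `|` msupp g.
Proof. exact: msuppD_le. Qed.

Lemma laurentE f : f = \sum_(a <- msupp f) lterm (f@_a) a.
Proof. exact: monalgE. Qed.

Lemma lmulw (d1 d2 : {fset 'rV[int]_m}) f g :
  msupp f `<=` d1 -> msupp g `<=` d2 ->
  lmul f g = \sum_(a <- d1) \sum_(b <- d2) lterm (f@_a * g@_b) (a + b).
Proof.
move=> le1 le2; rewrite /lmul (big_fset_incl _ le1) /=.
  apply/eq_bigr => a _; apply/big_fset_incl => // b _ /mcoeff_outdom ->.
  by rewrite mulr0 lterm0.
move=> a _ /mcoeff_outdom fa.
by rewrite big1 // => b _; rewrite fa mul0r lterm0.
Qed.

Lemma lmulC : commutative lmul.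
Proof.
move=> f g; rewrite /lmul exchange_big /=; apply/eq_bigr => b _.
by apply/eq_bigr => a _; rewrite mulrC addrC.
Qed.

Lemma lmulDl : left_distributive lmul +%R.
Proof.
move=> f g h; rewrite (lmulw (lsuppD f g) (fsubset_refl _)).
rewrite (lmulw (fsubsetUl _ (msupp g)) (fsubset_refl _)).
rewrite (lmulw (fsubsetUr (msupp f) _) (fsubset_refl _)).
rewrite -big_split /=; apply/eq_bigr => a _.
rewrite -big_split /=; apply/eq_bigr => b _.
by rewrite lcoeffD mulrDl ltermD.
Qed.

Lemma lmulDr : right_distributive lmul +%R.
Proof. by move=> f g h; rewrite lmulC lmulDl !(lmulC f). Qed.

Lemma lmul0l : left_zero 0 lmul.
Proof. by move=> f; rewrite /lmul msupp0 big_seq_fset0. Qed.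

Lemma lmul0r : right_zero 0 lmul.
Proof. by move=> f; rewrite lmulC lmul0l. Qed.

Lemma lmulUU x y a b : lmul (lterm x a) (lterm y b) = lterm (x * y) (a + b).
Proof.
by rewrite (lmulw msuppU_le msuppU_le) !big_seq_fset1 !mcoeffUU.
Qed.

Lemma lmulEl f g : lmul f g = \sum_(a <- msupp f) lmul (lterm (f@_a) a) g.
Proof.
apply/eq_bigr => a _.
rewrite (lmulw msuppU_le (fsubset_refl _)) big_seq_fset1.
by apply/eq_bigr => b _; rewrite mcoeffUU.
Qed.

Lemma lmulEr f g : lmul f g = \sum_(b <- msupp g) lmul f (lterm (g@_b) b).
Proof. by rewrite lmulC lmulEl; apply/eq_bigr => b _; rewrite lmulC. Qed.

Lemma lmulA : associative lmul.
Proof.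
move=> f g h.
rewrite [RHS](big_morph (lmul^~ h) (fun _ _ => lmulDl _ _ _) (lmul0l h)).
rewrite lmulEl; apply/eq_bigr => a _.
rewrite [LHS](big_morph (lmul _) (lmulDr _) (lmul0r _)).
rewrite [RHS](big_morph (lmul^~ h) (fun _ _ => lmulDl _ _ _) (lmul0l h)).
apply/eq_bigr => b _; rewrite [RHS]lmulEr.
rewrite [LHS](big_morph (lmul _) (lmulDr _) (lmul0r _)).
by apply/eq_bigr => c _; rewrite !lmulUU mulrA addrA.
Qed.

Lemma lmul1l : left_id (lmon 0) lmul.
Proof.
move=> f; rewrite /lmul (big_fset_incl _ (msuppU_le : _ `<=` [fset 0])) /=.
  rewrite big_seq_fset1 [RHS]laurentE; apply/eq_bigr => a _.
  by rewrite mcoeffUU mul1r add0r.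
move=> a _ /mcoeff_outdom fa.
by rewrite big1 // => b _; rewrite fa mul0r lterm0.
Qed.

Lemma lmon0_neq0 : lmon 0 != 0 :> laurent m.
Proof. by rewrite monalgU_eq0 oner_eq0. Qed.

HB.instance Definition _ := GRing.Zmodule_isComNzRing.Build (laurent m)
  lmulA lmulC lmul1l lmulDl lmon0_neq0.

End LaurentRing.

Section Laurent.
Variable m : nat.

Definition tvar (i : 'I_m) : laurent m := lmon (delta_mx 0 i).

Definition leval (R : comUnitRingType) (u : 'I_m -> R) (f : laurent m) : R :=
  \sum_(a <- msupp f) (f@_a)%:~R * \prod_(i < m) u i ^ a 0 i.

(* f(t_1^-1, ..., t_m^-1) *)
Definition linv (f : laurent m) : laurent m :=
  \sum_(a <- msupp f) (f@_a)%:~R * lmon (- a).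

End Laurent.

Section Seifert.
Variables (m : nat) (n : 'I_m -> nat).
Implicit Type A : 'M[int]_(\sum_i n i).

Definition boundary_link_seifert A : Prop :=
  (forall i j : 'I_m, i != j -> submxblock A i j = (submxblock A j i)^T) /\
  (forall i : 'I_m, \det (submxblock A i i - (submxblock A i i)^T) = 1).

Definition Tmx : 'M[laurent m]_(\sum_i n i) := \mxdiag_(i < m) (tvar i)%:M.

(* The monomial factor is det(T)^(-1/2); the n i are even for every boundary  *)
(* link Seifert matrix, so that the halving is then exact.                    *)
Definition alexander A : laurent m :=
  lmon (\row_i - ((n i)./2)%:Z) *
  \det (Tmx *m map_mx intr A - map_mx intr A^T).

End Seifert.

Definition mx2 (a b c d : int) : 'M[int]_2 :=
  \matrix_(i < 2, j < 2) nth 0 (nth [::] [:: [:: a; b]; [:: c; d]] i) j.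

(* [dsize i] is 2i, by a recursion under which the size of a 2x2 block matrix *)
(* with lower right block in 'M_2 is again, definitionally, a value of dsize. *)
Fixpoint dsize (i : nat) : nat := if i is i'.+1 then dsize i' + 2 else 0.

Lemma dsizeE i : dsize i = i.*2.
Proof. by elim: i => //= i ->; rewrite addn2. Qed.

(* The column of k blocks of size 2x2; C_i is [Cmx (v i) i.-1]. *)
Fixpoint Cmx (x : int) (k : nat) : 'M[int]_(dsize k, 2) :=
  match k with
  | 0 => 0
  | k'.+1 => col_mx (Cmx x k') (if k' is 0 then mx2 x 0 0 1 else mx2 x 1 0 1)
  end.

Definition Dmx (x e : int) : 'M[int]_2 :=
  let z := ((1 + e) %/ 2)%Z in mx2 x z (1 - z) 1.

(* The sequences v and eps are indexed from 1, and eps 1 is not used: B_1     *)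
(* does not depend on the sign of the first step of the path.                 *)
Fixpoint Bmx (v eps : nat -> int) (i : nat) : 'M[int]_(dsize i) :=
  match i with
  | 0 => 0
  | i'.+1 =>
      match i' return 'M[int]_(dsize i') -> 'M[int]_(dsize i'.+1) with
      | 0 => fun=> mx2 (v 1%N) 0 (-1) 1
      | k.+1 => fun B => let C := Cmx (v k.+2) k.+1 in
                block_mx B C C^T (Dmx (v k.+2) (eps k.+2))
      end (Bmx v eps i')
  end.

(* diag(t_{s 1}, t_{s 1}, ..., t_{s l}, t_{s l}) *)
Definition Ttilde (m : nat) (s : nat -> 'I_m) (l : nat) :
    'M[laurent m]_(dsize l) :=
  diag_mx (\row_j tvar (s (j./2).+1)).

(* The permutation moves the consecutive pairs of coordinates {2k, 2k+1} and  *)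
(* preserves the order inside each of them.                                   *)
Definition permutes_pairs (d : nat) (pi : 'S_d) : Prop :=
  forall i j : 'I_d, ~~ odd i -> j = i.+1 :> nat ->
    ~~ odd (pi i) /\ pi j = (pi i).+1 :> nat.

(* Main.v *)
Require Import Defs.
From mathcomp Require Import all_boot all_order all_fingroup all_algebra.
From mathcomp Require Import ring zify.

Set Implicit Arguments.
Unset Strict Implicit.
Unset Printing Implicit Defensive.

Import Order.TTheory GRing.Theory Num.Theory.
Local Open Scope ring_scope.

(** Write [M = T~ B - B^T].  Two separate facts about [B] carry the theorem.

    The skew part [S = B - B^T] is block diagonal with 2x2 blocks
    +-(0, 1; -1, 0), because the off-diagonal blocks of [B] are symmetric to
    each other.  So [S] squares to -1, and so does every diagonal block of its
    relabelling, as these blocks are unions of 2x2 ones.  A skew integer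
    matrix with square -1 has determinant 1 ([det_skew_square_oppr1]); this
    spares any analysis of where the pairs of coordinates end up inside a
    block, and of the parity of the block sizes.

    For the Alexander polynomial, count from 0 and let [x_i] be the variable of
    the step from [p i] to [p (i + 1)].  List the even coordinates before the
    odd ones.  Then [M] becomes a 2x2 block matrix (D V, X; Y, D J), where
    [D = diag (x_i - 1)], [V] has entries [v (max i j + 1)], [J] is all ones,
    and [X], [Y] are triangular with [X_ii Y_ii = - x_i] ([BmxE],
    [XYentry_diag]).  The lower right block has rank one.  If [y] is a row with
    [y X] constant and [h] a column with [Y h] proportional to the column of
    the [x_i - 1], scaled so that [(Y h) (y X) = D J], then block elimination
    gives [det M = (prod x_i) (1 - y (D V) h)] ([det_block_rank1]).  The
    triangular systems for [y] and [h] are solved by walking along the path: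
    with [q k = t^(- p k)] and [q' k = t^(p k)] the solutions satisfy
    [y_i (x_i - 1) = q i - q (i + 1)] and [h_i = q' i - q' (i + 1)] ([yX],
    [Yh]).  As [V] is the sum over [k] of [w k] times the rank one matrix with
    ones at the indices below [k], both sums telescope, and
    [y (D V) h = sum_k w_k (1 - t^(- p k)) (1 - t^(p k))] ([yVh]).  This is
    exactly [1 - Delta], as the [w k] are the coefficients [c] placed along
    the path ([sum_path_weights]).  The factor [prod x_i] is [det (T) ^ (1/2)],
    since each [t_i] occurs twice in [T] for each step in direction [i].

    Nothing is divided by an [x_i - 1], so the computation is valid in any
    commutative ring.  The positive first step enters through [x_0 q 1 = 1]:
    the first block of [B] is that of a positive step, whatever the path. *)

(** * Determinants *)

(** Conjugation by a permutation and the cast between provably equal sizes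
    are both instances of [mxsub f f] with [f] injective; this avoids
    manipulating casts. *)
Section Reindexing.
Variables (d d' : nat) (f : 'I_d -> 'I_d').
Hypotheses (eq_d : d = d') (f_inj : injective f).

Lemma det_mxsub (R : comNzRingType) (M : 'M[R]_d') :
  \det (mxsub f f M) = \det M.
Proof.
move: f f_inj M; case: _ / eq_d => g g_inj M.
have -> : mxsub g g M = row_perm (perm g_inj) (col_perm (perm g_inj) M).
  by apply/matrixP => i j; rewrite !mxE !permE.
rewrite row_permE col_permE !det_mulmx !det_perm odd_permV mulrCA.
by rewrite -signr_addb addbb mulr1.
Qed.

Lemma bij_of_eq_dim : bijective f.
Proof. by apply: inj_card_bij => //; rewrite !card_ord eq_d. Qed.

Lemma mxsub_mul_inj (R : comNzRingType) (M N : 'M[R]_d') :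
  mxsub f f (M *m N) = mxsub f f M *m mxsub f f N.
Proof.
apply/matrixP => i j; rewrite !mxE (reindex f) /=; last first.
  exact: onW_bij bij_of_eq_dim.
by apply: eq_bigr => k _; rewrite !mxE.
Qed.

Lemma mxtrace_mxsub (R : comNzRingType) (M : 'M[R]_d') :
  \tr (mxsub f f M) = \tr M.
Proof.
rewrite /mxtrace [RHS](reindex f) /=; last exact: onW_bij bij_of_eq_dim.
by apply: eq_bigr => k _; rewrite !mxE.
Qed.

End Reindexing.

(** As [S] is skew with square -1, [(1 + S) S = - (1 - S) = - (1 + S)^T], and
    [det (1 + S)] is nonzero because [(1 + S) (1 - S) = 2].  Cancelling it
    gives [det S = (-1)^d], while [S S = -1] gives [(det S)^2 = (-1)^d]; hence
    [det S] is idempotent and nonzero. *)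
Lemma det_skew_square_oppr1 d (S : 'M[int]_d) :
  S^T = - S -> S *m S = - 1%:M -> \det S = 1.
Proof.
move=> skewS sqS.
have trS : (1%:M + S)^T = 1%:M - S by rewrite linearD /= trmx1 skewS.
have det2 : \det (1%:M + S) * \det (1%:M + S) = 2 ^+ d.
  rewrite -[X in _ * X]det_tr trS -det_mulmx mulmxBr mulmx1 mulmxDl mul1mx sqS.
  by rewrite [S - _]addrC opprD opprK addrACA subrr addr0 -raddfD det_scalar.
have nz : \det (1%:M + S) != 0.
  apply/eqP => det0; move/eqP: det2.
  by rewrite det0 mul0r eq_sym expf_eq0 andbF.
have detS : \det S = (-1) ^+ d.
  apply: (mulfI nz); rewrite -det_mulmx mulmxDl mul1mx sqS.
  by rewrite -opprB -trS -scaleN1r detZ det_tr mulrC.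
have := congr1 determinant sqS.
rewrite det_mulmx -scaleN1r detZ det1 mulr1 -detS => detSS.
have nzS : \det S != 0 by rewrite detS signr_eq0.
by apply: (mulfI nzS); rewrite detSS mulr1.
Qed.

(** Both sides are determinants of the products, in the two orders, of
    (1, u; v, 1) with the unipotent matrix (1, 0; -v, 1). *)
Lemma det_rank1_update (R : comNzRingType) d (u : 'cV[R]_d) (v : 'rV[R]_d) :
  \det (1%:M - u *m v) = 1 - (v *m u) 0 0.
Proof.
have E1 : block_mx 1%:M u v 1%:M *m block_mx 1%:M 0 (- v) 1%:M
   = block_mx (1%:M - u *m v) u 0 (1%:M : 'M_1).
  rewrite mulmx_block !mulmx1 !mul1mx !mulmx0 !add0r mulmxN.
  by rewrite subrr.
have E2 : block_mx 1%:M 0 (- v) 1%:M *m block_mx 1%:M u v 1%:M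
   = block_mx 1%:M u 0 (1%:M - v *m u).
  rewrite mulmx_block !mulmx1 !mul1mx !mul0mx !addr0 mulNmx.
  by rewrite addNr addrC.
have /(congr1 determinant) := E1; have /(congr1 determinant) := E2.
rewrite !det_mulmx !det_ublock !det1 !mul1r !mulr1 [in X in X -> _]mulrC => ->.
by move=> <-; rewrite det_mx11 !mxE.
Qed.

(** Pulling [Y] out of the lower rows and [X] out of the right columns leaves
    (V, 1; 1, h y), which column operations reduce to the rank one update
    [1 - h (y V)]; the sign comes from exchanging the two halves.  The lower
    right block is written as a product so that neither [X] nor [Y] has to be
    inverted. *)
Lemma det_block_rank1 (R : comNzRingType) d (V X Y : 'M[R]_d)
    (y : 'rV[R]_d) (h : 'cV[R]_d) :
  \det (block_mx V X Y (Y *m h *m (y *m X))) =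
  (-1) ^+ d * (\det X * \det Y) * (1 - (y *m V *m h) 0 0).
Proof.
have -> : block_mx V X Y (Y *m h *m (y *m X)) =
    block_mx 1%:M 0 0 Y *m block_mx V 1%:M 1%:M (h *m y) *m block_mx 1%:M 0 0 X.
  rewrite !mulmx_block !(mulmx0, mul0mx, mulmx1, mul1mx, addr0, add0r).
  by rewrite !mulmxA.
rewrite !det_mulmx !det_ublock det1 !mul1r.
(* The last two column operations put 1 on the diagonal instead of exchanging
   the two block columns, so that all the factors have determinant 1. *)
have E : block_mx V 1%:M 1%:M (h *m y) *m block_mx 1%:M 0 (- V) 1%:M
     *m block_mx 1%:M 0 1%:M 1%:M *m block_mx 1%:M (- 1%:M) 0 1%:M
   = block_mx 1%:M 0 (1%:M - h *m y *m V + h *m y) (- (1%:M - h *m y *m V)).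
  rewrite !mulmx_block !(mulmx0, mul0mx, mulmx1, mul1mx, addr0, add0r).
  rewrite !mulmxN !mulmx1 subrr add0r addNr; congr block_mx.
  by rewrite opprD subrK.
have /(congr1 determinant) := E.
rewrite !det_mulmx !(det_ublock, det_lblock) !det1 !mulr1 !mul1r => ->.
rewrite -scaleN1r detZ -mulmxA det_rank1_update; ring.
Qed.

(** * Entries and skew part of B *)

(** The number z of the block D with 0-based index [i]. *)
Definition zsign (eps : nat -> int) (i : nat) : int := ((1 + eps i.+1) %/ 2)%Z.

(** Entry in row [2 i] and column [2 j + 1] of B, for 0-based block indices; the
    first pair of coordinates follows its own rule, both on the diagonal and
    in the blocks C. *)
Definition Bupper (eps : nat -> int) (i j : nat) : int :=
  if i == j then (if i == 0%N then 0 else zsign eps i) else (0 < i < j)%N%:R.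

(** Entry in row [2 i + 1] and column [2 j] of B. *)
Definition Blower (eps : nat -> int) (i j : nat) : int :=
  if i == j then (if i == 0%N then -1 else 1 - zsign eps i)
  else (0 < j < i)%N%:R.

Definition Bentry (v eps : nat -> int) (a b : nat) : int :=
  match odd a, odd b with
  | false, false => v (maxn a./2 b./2).+1
  | false, true => Bupper eps a./2 b./2
  | true, false => Blower eps a./2 b./2
  | true, true => 1
  end.

Lemma CmxE x k (a : 'I_(dsize k)) (b : 'I_2) :
  Cmx x k a b = match odd a, odd b with
    | false, false => x
    | false, true => (0 < a./2)%N%:R
    | true, false => 0
    | true, true => 1
    end.
Proof.
elim: k a => [|k IHk] a; first by case: a.
rewrite [Cmx _ _]/=; case: (@split_ordP (dsize k) 2 a) => a' ->.
  by rewrite col_mxEu IHk.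
rewrite col_mxEd [val _]/= dsizeE oddD odd_double /= halfD odd_double.
rewrite doubleK /=.
case: k {IHk a} => [|k]; rewrite mxE;
  case: a' => [[|[|a']] //= ?]; case: b => [[|[|b]] //= ?]; 
  rewrite /= ?addn0 ?addSn //=.
Qed.

(** The recursion for B, in a form that rewriting can use: simplification would
    also unfold the smaller B and the blocks C. *)
Lemma BmxSS v eps l : Bmx v eps l.+2 =
  block_mx (Bmx v eps l.+1) (Cmx (v l.+2) l.+1) (Cmx (v l.+2) l.+1)^T
    (Dmx (v l.+2) (eps l.+2)).
Proof. by []. Qed.

Lemma BmxE v eps l (a b : 'I_(dsize l)) : Bmx v eps l a b = Bentry v eps a b.
Proof.
elim: l a b => [|l IHl] a b; first by case: a.
have ltE k (c : 'I_(dsize k)) : (c./2 < k)%N.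
  by have := ltn_ord c; rewrite [X in (_ < X)%N]dsizeE; lia.
have halfE k (c : 'I_2) : (rshift (dsize k) c)./2 = k.
  by rewrite [val _]/= dsizeE; case: c => c /=; lia.
have oddE k (c : 'I_2) : odd (rshift (dsize k) c) = odd c.
  by rewrite [val _]/= dsizeE oddD odd_double.
have lhalfE k (c : 'I_(dsize k)) : (lshift 2 c)./2 = c./2 by [].
have loddE k (c : 'I_(dsize k)) : odd (lshift 2 c) = odd c by [].
case: l IHl a b => [|l] IHl a b.
  by case: a b => [[|[|a]] // ?] [[|[|b]] // ?]; rewrite /= mxE //=.
rewrite BmxSS /Bentry.
case: (@split_ordP (dsize l.+1) 2 a) => a' ->;
  case: (@split_ordP (dsize l.+1) 2 b) => b' ->.
- by rewrite block_mxEul IHl.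
- rewrite block_mxEur [LHS](@CmxE _ l.+1) oddE halfE lhalfE loddE.
  have := ltE _ a'; rewrite /Bupper /Blower; case: odd; case: odd => //= alt.
  + by rewrite ltn_eqF // ltnNge ltnW ?andbF.
  + by rewrite ltn_eqF // alt andbT.
  + by rewrite (maxn_idPr (ltnW alt)).
- rewrite block_mxEdl mxE [LHS](@CmxE _ l.+1) oddE halfE lhalfE loddE.
  have := ltE _ b'; rewrite /Bupper /Blower.
  case: (odd b'); case: (odd a') => //= blt.
  + by rewrite gtn_eqF // (ltnNge l.+1) ltnW ?andbF.
  + by rewrite gtn_eqF // blt andbT.
  + by rewrite (maxn_idPl (ltnW blt)).
- rewrite block_mxEdr !oddE !halfE /Bupper /Blower !eqxx maxnn /Dmx.
  rewrite mxE /zsign.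
  by case: a' b' => [[|[|a']] // ?] [[|[|b']] // ?].
Qed.

Lemma Bmx_sym_off v eps l (a b : 'I_(dsize l)) :
  a./2 != b./2 -> Bmx v eps l a b = Bmx v eps l b a.
Proof.
rewrite !BmxE /Bentry maxnC /Bupper /Blower (eq_sym b./2) => /negbTE ->.
by case: odd; case: odd.
Qed.

Definition skew_part d (M : 'M[int]_d) : 'M[int]_d := M - M^T.

Lemma Dmx_skew_square (x e : int) : e = 1 \/ e = -1 ->
  skew_part (Dmx x e) *m skew_part (Dmx x e) = - 1%:M.
Proof.
move=> e_sign; apply/matrixP => i j.
rewrite !mxE big_ord_recl big_ord1 !mxE.
have [z1 z0] : ((1 + 1) %/ 2 = 1)%Z /\ ((1 - 1) %/ 2 = 0)%Z by [].
case: e_sign => ->; rewrite ?z1 ?z0;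
  by case: i j => [[|[|i]] // ?] [[|[|j]] // ?] /=; ring.
Qed.

(** The blocks C cancel, so the skew part is block diagonal. *)
Lemma Bmx_skew_square (v eps : nat -> int) l :
  (forall t, (1 <= t <= l)%N -> eps t = 1 \/ eps t = -1) ->
  skew_part (Bmx v eps l) *m skew_part (Bmx v eps l) = - 1%:M.
Proof.
elim: l => [|[|l] IHl] eps_sign.
- by apply/matrixP => - [].
- apply/matrixP => i j; rewrite !mxE big_ord_recl big_ord1 !mxE.
  by case: i j => [[|[|i]] // ?] [[|[|j]] // ?] /=; ring.
have {}IHl := IHl (fun t tlt => eps_sign t ltac:(lia)).
have skewD := Dmx_skew_square (v l.+2) (eps_sign l.+2 ltac:(lia)).
have -> : skew_part (Bmx v eps l.+2) = block_mx (skew_part (Bmx v eps l.+1))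
    0 0 (skew_part (Dmx (v l.+2) (eps l.+2))) :> 'M_(dsize l.+1 + 2).
  rewrite /skew_part BmxSS tr_block_mx trmxK opp_block_mx add_block_mx.
  by rewrite !subrr.
rewrite [LHS](@mulmx_block _ (dsize l.+1) 2 (dsize l.+1) 2 (dsize l.+1) 2).
rewrite !(mulmx0, mul0mx, addr0, add0r) IHl skewD.
apply: etrans (congr1 -%R (esym (scalar_mx_block (dsize l.+1) 2 1))).
by rewrite opp_block_mx !oppr0.
Qed.

(** * Determinant of the twisted matrix *)

(** The reindexing that lists all the even coordinates before the odd ones. *)
Section Interleave.
Variable l : nat.

Definition interleave_nat (k : 'I_(l + l)) : nat :=
  match split k with inl i => i.*2 | inr i => i.*2.+1 end.

Lemma interleave_lt k : (interleave_nat k < dsize l)%N.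
Proof.
by rewrite /interleave_nat dsizeE; case: splitP => i _; have := ltn_ord i; lia.
Qed.

Definition interleave k : 'I_(dsize l) := Ordinal (interleave_lt k).

Lemma interleave_l i : interleave (lshift l i) = i.*2 :> nat.
Proof.
by rewrite /= /interleave_nat -[lshift l i]/(unsplit (inl i)) unsplitK.
Qed.

Lemma interleave_r i : interleave (rshift l i) = i.*2.+1 :> nat.
Proof.
by rewrite /= /interleave_nat -[rshift l i]/(unsplit (inr i)) unsplitK.
Qed.

Lemma interleave_inj : injective interleave.
Proof.
move=> a b /(congr1 (@nat_of_ord _)).
case: (split_ordP a) => i ->; case: (split_ordP b) => j ->;
  rewrite ?(interleave_l, interleave_r) => ij; try lia.
- by congr lshift; apply: val_inj => /=; lia.
- by congr rshift; apply: val_inj => /=; lia.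
Qed.

Lemma interleave_dim : (l + l = dsize l)%N.
Proof. by rewrite dsizeE addnn. Qed.

End Interleave.

Lemma telescope_trunc (V : zmodType) (F : nat -> V) (l j : nat) :
  \sum_(k < l) (F k - F k.+1) *+ (k < j)%N = F 0%N - F (minn j l).
Proof.
elim: l => [|l IHl]; first by rewrite big_ord0 minn0 subrr.
rewrite big_ord_recr /= IHl; have [lj|jl] : (l < j \/ j <= l)%N by lia.
  by rewrite (minn_idPr (ltnW lj)) (minn_idPr lj) lj mulr1n addrA subrK.
by rewrite (minn_idPl jl) (minn_idPl (leqW jl)) ltnNge jl addr0.
Qed.

(** Freezing [F] at index 1 turns this into a truncated sum that starts at 0. *)
Lemma telescope_inner (V : zmodType) (F : nat -> V) (l j : nat) :
  (0 < j < l)%N -> \sum_(k < l) (F k - F k.+1) *+ (0 < k < j)%N = F 1%N - F j.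
Proof.
case/andP=> j0 jl.
have -> : F 1%N - F j = (F \o maxn 1) 0%N - (F \o maxn 1) (minn j l).
  by rewrite /= (minn_idPl (ltnW jl)) (maxn_idPr j0).
rewrite -telescope_trunc; apply: eq_bigr => -[[|k] klt] _ //=.
  by rewrite subrr mulr0n mul0rn.
by rewrite !(maxn_idPr _).
Qed.

(** In the application [x i] is the variable of the step from [p i] to
    [p (i + 1)], and [q k], [q' k] are the monomials [t^(- p k)], [t^(p k)].
    Only the way in which they change along the path is used, in a form that
    needs no inverses of the [x i]. *)
Section TwistedDet.
Variables (R : comNzRingType) (l : nat) (v eps w : nat -> int).
Variables x q q' : nat -> R.
Hypothesis l_gt0 : (0 < l)%N.
Hypothesis eps1 : eps 1%N = 1.
Hypothesis eps_sign : forall t, (1 <= t <= l)%N -> eps t = 1 \/ eps t = -1.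
Hypothesis vE : forall i, (1 <= i <= l)%N -> v i = \sum_(i <= j < l.+1) w j.
Hypotheses (q0 : q 0%N = 1) (q'_0 : q' 0%N = 1).
Hypothesis step_up : forall i, (i < l)%N -> eps i.+1 = 1 ->
  q i = x i * q i.+1 /\ q' i.+1 = x i * q' i.
Hypothesis step_down : forall i, (i < l)%N -> eps i.+1 = -1 ->
  q i.+1 = x i * q i /\ q' i = x i * q' i.+1.

Let eps_step i (il : (i < l)%N) : eps i.+1 = 1 \/ eps i.+1 = -1.
Proof. by apply: eps_sign; lia. Qed.

(** Off-diagonal blocks of [M = T~ B - B^T], after [interleave]: rows of even
    and columns of odd coordinates for [Xentry], the opposite for [Yentry]. *)
Definition Xentry i j : R := x i * (Bupper eps i j)%:~R - (Blower eps j i)%:~R.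
Definition Yentry i j : R := x i * (Blower eps i j)%:~R - (Bupper eps j i)%:~R.
(** The solutions [y], [h] of the triangular systems [y X = q 1] and
    [Y h = q' 1 (x - 1)].  The case distinction in [yentry] stands for the
    quotient of [q i - q (i + 1)] by [x i - 1]. *)
Definition yentry i : R := if eps i.+1 == 1 then q i.+1 else - q i.
Definition hentry i : R := q' i - q' i.+1.

Lemma zsign1 i : eps i.+1 = 1 -> zsign eps i = 1.
Proof. by rewrite /zsign => ->. Qed.
Lemma zsignN1 i : eps i.+1 = -1 -> zsign eps i = 0.
Proof. by rewrite /zsign => ->. Qed.

Lemma Xentry_off i j : i != j -> Xentry i j = (x i - 1) *+ (0 < i < j)%N.
Proof.
rewrite /Xentry /Bupper /Blower (eq_sym j) => /negbTE->.
by case: (_ && _); rewrite ?(mulr1, mulr0, subr0).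
Qed.

Lemma Yentry_off i j : i != j -> Yentry i j = (x i - 1) *+ (0 < j < i)%N.
Proof.
rewrite /Yentry /Bupper /Blower (eq_sym j) => /negbTE->.
by case: (_ && _); rewrite ?(mulr1, mulr0, subr0).
Qed.

(** The two diagonal entries are [x i] and -1 in some order; for [i = 0] they
    are 1 and [- x 0]. *)
Lemma XYentry_diag i : (i < l)%N -> Xentry i i * Yentry i i = - x i.
Proof.
move=> il; rewrite /Xentry /Yentry /Bupper /Blower !eqxx.
case: eqP => _; first by ring.
by case: (eps_step il) => e; rewrite ?(zsign1 e) ?(zsignN1 e); ring.
Qed.

Lemma yentry_step i : (i < l)%N -> yentry i * (x i - 1) = q i - q i.+1.
Proof.
move=> il; rewrite /yentry.
case: (eps_step il) => e; rewrite e /=; [have [E _] := step_up il e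
  | have [E _] := step_down il e]; rewrite E; ring.
Qed.

(** Above the diagonal the sum telescopes to [q 1 - q j], and the diagonal
    entry contributes [q j].  The first column has only its diagonal entry 1,
    the value that a positive first step requires. *)
Lemma yX j : (j < l)%N -> \sum_(i < l) yentry i * Xentry i j = q 1%N.
Proof.
move=> jl; have diagE : yentry j * Xentry j j = if j == 0%N then q 1%N else q j.
  rewrite /Xentry /Bupper /Blower !eqxx /yentry.
  case: (eqVneq j 0%N) => [->|_]; first by rewrite eps1 eqxx; ring.
  case: (eps_step jl) => e; rewrite e ?(zsign1 e) ?(zsignN1 e) /=; last by ring.
  by have [-> _] := step_up jl e; ring.
rewrite (bigD1 (Ordinal jl)) //= diagE.
rewrite (eq_bigr (fun i : 'I_l => (q i - q i.+1) *+ (0 < i < j)%N)); last first.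
  by move=> i ij; rewrite Xentry_off // mulrnAr yentry_step.
have [j0|jn0] := eqVneq j 0%N.
  by rewrite big1 ?addr0 // => i _; rewrite j0 ltn0 andbF.
have := @telescope_inner _ q l j; rewrite lt0n jn0 jl => /(_ isT).
rewrite (bigD1 (Ordinal jl)) //= ltnn andbF add0r => ->.
by rewrite addrC subrK.
Qed.

Lemma Yh i :
  (i < l)%N -> \sum_(j < l) Yentry i j * hentry j = q' 1%N * (x i - 1).
Proof.
move=> il; have diagE : Yentry i i * hentry i =
    if i == 0%N then q' 1%N * (x i - 1) else q' i * (x i - 1).
  rewrite /Yentry /Bupper /Blower !eqxx /hentry.
  case: eqP => [->|_].
    by have [_ ->] := step_up l_gt0 eps1; rewrite q'_0; ring.
  case: (eps_step il) => e; rewrite ?(zsign1 e) ?(zsignN1 e) /=.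
    by have [_ ->] := step_up il e; ring.
  by have [_ E] := step_down il e; rewrite E; ring.
rewrite (bigD1 (Ordinal il)) //= diagE.
rewrite (eq_bigr (fun j : 'I_l =>
    (x i - 1) * ((q' j - q' j.+1) *+ (0 < j < i)%N))); last first.
  by move=> j ij; rewrite Yentry_off 1?eq_sym // mulrnAl mulrnAr.
have [i0|in0] := eqVneq i 0%N.
  by rewrite big1 ?addr0 // => j _; rewrite i0 ltn0 andbF mulr0.
have := @telescope_inner _ q' l i; rewrite lt0n in0 il => /(_ isT).
rewrite (bigD1 (Ordinal il)) //= ltnn andbF add0r -mulr_sumr => ->.
by ring.
Qed.

(** [v (max i j)] is the sum of the weights [w k] over the [k] that are at least
    both indices; so for each [k] the double sum splits into a product of
    two truncated telescoping sums. *)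
Lemma yVh : \sum_(i < l) \sum_(j < l)
    yentry i * ((x i - 1) * (v (maxn i j).+1)%:~R) * hentry j =
  \sum_(k < l) (w k.+1)%:~R * ((1 - q k.+1) * (1 - q' k.+1)).
Proof.
transitivity (\sum_(i < l) \sum_(j < l) \sum_(k < l) (w k.+1)%:~R *
   (((q i - q i.+1) *+ (i < k.+1)%N) * ((q' j - q' j.+1) *+ (j < k.+1)%N))).
  apply: eq_bigr => i _; apply: eq_bigr => j _.
  have lt_max : (maxn i j < l)%N by rewrite gtn_max !ltn_ord.
  rewrite mulrA yentry_step // vE ?lt_max // (rmorph_sum intr) /=.
  rewrite big_add1 /= big_geq_mkord (big_mkcond (fun k : 'I_l => _)) /=.
  rewrite mulr_sumr mulr_suml; apply: eq_bigr => k _.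
  rewrite !ltnS geq_max; case: (i <= k)%N; case: (j <= k)%N;
    rewrite /= ?(mulr0n, mulr1n, mulr0, mul0r) // /hentry; ring.
under [LHS]eq_bigr do rewrite exchange_big.
rewrite exchange_big; apply: eq_bigr => k _ /=.
have tel (f : nat -> R) : f 0%N = 1 ->
    1 - f k.+1 = \sum_(i < l) (f i - f i.+1) *+ (i < k.+1)%N.
  by move=> f0; rewrite telescope_trunc f0 (minn_idPl (ltn_ord k)).
rewrite (tel _ q0) (tel _ q'_0).
rewrite big_distrlr big_distrr /=; apply: eq_bigr => i _.
by rewrite big_distrr.
Qed.

(** The matrix [T~ M - M^T], with the diagonal of [T~] given by [x]. *)
Definition twist d (M : 'M[int]_d) : 'M[R]_d :=
  \matrix_(a, b) (x a./2 * (M a b)%:~R - (M b a)%:~R).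

Lemma det_twist : \det (twist (Bmx v eps l)) = \prod_(i < l) x i *
  (1 - \sum_(k < l) (w k.+1)%:~R * ((1 - q k.+1) * (1 - q' k.+1))).
Proof.
pose X : 'M[R]_l := \matrix_(i, j) Xentry i j.
pose Y : 'M[R]_l := \matrix_(i, j) Yentry i j.
pose V : 'M[R]_l := \matrix_(i, j) ((x i - 1) * (v (maxn i j).+1)%:~R).
pose y : 'rV[R]_l := \row_i yentry i.
pose h : 'cV[R]_l := \col_i hentry i.
have yXE j : (y *m X) 0 j = q 1%N.
  by rewrite mxE -[RHS](yX (ltn_ord j)); apply: eq_bigr => i _; rewrite !mxE.
have YhE i : (Y *m h) i 0 = q' 1%N * (x i - 1).
  by rewrite mxE -[RHS](Yh (ltn_ord i)); apply: eq_bigr => j _; rewrite !mxE.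
have q1 : q 1%N * q' 1%N = 1.
  by have [E1 ->] := step_up l_gt0 eps1; rewrite q'_0 mulr1 mulrC -E1.
rewrite -(det_mxsub (interleave_dim l) (@interleave_inj l)).
have -> : mxsub (@interleave l) (@interleave l) (twist (Bmx v eps l)) =
    block_mx V X Y (Y *m h *m (y *m X)).
  apply/matrixP => a b; rewrite mxE mxE !BmxE.
  case: (split_ordP a) => i ->; case: (split_ordP b) => j ->;
    rewrite !(interleave_l, interleave_r) /Bentry /= ?odd_double;
    rewrite ?doubleK ?uphalf_double.
  - by rewrite block_mxEul mxE maxnC; ring.
  - by rewrite block_mxEur mxE.
  - by rewrite block_mxEdl mxE.
  - by rewrite block_mxEdr mxE big_ord1 yXE YhE mulrAC [q' _ * _]mulrC q1; ring.
rewrite det_block_rank1.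
have -> : \det X = \prod_(i < l) Xentry i i.
  rewrite -det_tr det_trig; first by apply: eq_bigr => i _; rewrite !mxE.
  apply/is_trig_mxP => i j ij; rewrite !mxE Xentry_off ?gtn_eqF //.
  by rewrite (ltnNge j) (ltnW ij) andbF.
have -> : \det Y = \prod_(i < l) Yentry i i.
  rewrite det_trig; first by apply: eq_bigr => i _; rewrite !mxE.
  apply/is_trig_mxP => i j ij; rewrite !mxE Yentry_off ?ltn_eqF //.
  by rewrite (ltnNge j) (ltnW ij) andbF.
rewrite -big_split /=; congr (_ * (1 - _)).
  rewrite (eq_bigr (fun i : 'I_l => - x i)) => [|i _]; last exact: XYentry_diag.
  by rewrite prodrN card_ord signrMK.
rewrite -yVh -mulmxA mxE; apply: eq_bigr => i _.
rewrite mxE [X in _ * X]mxE big_distrr; apply: eq_bigr => j _ /=.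
by rewrite !mxE mulrA.
Qed.

End TwistedDet.

(** * Laurent monomials *)

Lemma lmonD m (a b : 'rV[int]_m) : lmon (a + b) = lmon a * lmon b.
Proof. by rewrite -[RHS]/(lmul (lterm 1 a) (lterm 1 b)) lmulUU mulr1. Qed.

Lemma lmon_sum m I (r : seq I) (F : I -> 'rV[int]_m) :
  \prod_(i <- r) lmon (F i) = lmon (\sum_(i <- r) F i).
Proof. by rewrite (big_morph (@lmon m) (@lmonD m) (erefl (lmon 0))). Qed.

Definition unit_row m (i : 'I_m) : 'rV[int]_m := delta_mx 0 i.

Lemma coef_tvar m (i j : 'I_m) : (tvar i)@_(unit_row j) = (i == j)%:R :> int.
Proof.
rewrite mcoeffU; congr (_ *+ nat_of_bool _).
apply/eqP/eqP => [/rowP/(_ i)|-> //].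
by rewrite !mxE !eqxx /=; case: eqVneq.
Qed.

Lemma coef_sum m I (r : seq I) (F : I -> laurent m) a :
  (\sum_(i <- r) F i)@_a = \sum_(i <- r) (F i)@_a.
Proof. by apply: (big_morph _ (fun f g => lcoeffD f g a)); exact: mcoeff0. Qed.

Lemma tvar_inj m : injective (@tvar m).
Proof.
move=> i j /(congr1 (fun f : laurent m => f@_(unit_row j))).
by rewrite !coef_tvar eqxx; case: eqVneq.
Qed.

Lemma sum_half l (V : nmodType) (F : nat -> V) :
  \sum_(a < dsize l) F a./2 = (\sum_(k < l) F k) *+ 2.
Proof.
rewrite (reindex (@interleave l)); last first.
  exact: onW_bij (bij_of_eq_dim (interleave_dim l) (@interleave_inj l)).
rewrite big_split_ord mulr2n; congr (_ + _); apply: eq_bigr => k _.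
  by rewrite interleave_l doubleK.
by rewrite interleave_r /= uphalf_double.
Qed.

(** * Block submatrices and relabelled coordinates *)

Lemma submxblock_mul_diag (R : comNzRingType) m (n : 'I_m -> nat)
    (M N : 'M[R]_(\sum_i n i)) i :
  (forall j k, j != k -> submxblock M j k = 0) ->
  submxblock M i i *m submxblock N i i = submxblock (M *m N) i i.
Proof.
move=> M_off; rewrite -[in RHS](submxblockK M) -[in RHS](submxblockK N).
rewrite mul_mxblock mxblockK (bigD1 i) //=.
rewrite [X in _ + X]big1 ?addr0 // => j ji.
by rewrite M_off 1?eq_sym // mul0mx.
Qed.

Section Relabel.
Variables (d d' : nat) (e : d = d') (pi : 'S_d).

Definition relabel (a : 'I_d') : 'I_d := pi (cast_ord (esym e) a).

Lemma relabel_inj : injective relabel.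
Proof. by move=> a b /perm_inj/cast_ord_inj. Qed.

Lemma castmx_conj_perm (R : comNzRingType) (M : 'M[R]_d) :
  castmx (e, e) (perm_mx pi *m M *m perm_mx pi^-1) = mxsub relabel relabel M.
Proof.
by rewrite castmxEsub -row_permE -col_permE; apply/matrixP => a b; rewrite !mxE.
Qed.

End Relabel.

Lemma invmx_perm (R : comUnitRingType) d (pi : 'S_d) :
  invmx (perm_mx pi : 'M[R]_d) = perm_mx pi^-1.
Proof.
rewrite -[RHS](mulKmx (unitmx_perm R pi)) -perm_mxM mulgV perm_mx1.
by rewrite mulmx1.
Qed.

(** * Sums along the path *)

(** The weights vanish off the image of [tau], and [p \o tau] enumerates the
    support of [c] without repetition; so a weighted sum along the path is
    the sum over the support, however often the path visits a point. *)
Lemma sum_path_weights (R : pzRingType) (T : choiceType)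
    (c : {fsfun T -> int with 0}) (r l : nat) (alpha : 'I_r -> T)
    (p : nat -> T) (tau : 'I_r -> nat) (w : nat -> int) (G : T -> R) :
  injective alpha ->
  (forall a, c a <> 0 <-> exists i, alpha i = a) ->
  (forall i, (1 <= tau i <= l)%N) ->
  (forall i, p (tau i) = alpha i) ->
  (forall i, w (tau i) = c (p (tau i))) ->
  (forall j, (1 <= j <= l)%N -> (forall i, j <> tau i) -> w j = 0) ->
  \sum_(k < l) (w k.+1)%:~R * G (p k.+1) =
  \sum_(a <- finsupp c) (c a)%:~R * G a.
Proof.
move=> alpha_inj alpha_supp tau_range p_tau w_tau w_other.
have supp_perm : perm_eq (finsupp c) (map alpha (enum 'I_r)).
  apply: uniq_perm => [||a]; first exact: fset_uniq.
    by rewrite map_inj_uniq // enum_uniq.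
  rewrite mem_finsupp; apply/idP/mapP => [/eqP/alpha_supp[i <-]|[i _ ->]].
    by exists i; rewrite ?mem_enum.
  by apply/eqP/alpha_supp; exists i.
rewrite (perm_big _ supp_perm) big_map big_enum /=.
pose F k := (w k)%:~R * G (p k).
transitivity (\sum_(k <- index_iota 1 l.+1) F k).
  by rewrite big_add1 /= big_mkord.
rewrite (bigID (mem (codom tau))) /= [X in _ + X]big1_seq ?addr0; last first.
  move=> k /andP[ktau]; rewrite mem_index_iota ltnS => kl.
  rewrite /F w_other ?mul0r // => i ki; case/negP: ktau.
  by rewrite ki codom_f.
have tau_inj : injective tau.
  by move=> i j /(congr1 p); rewrite !p_tau => /alpha_inj.
rewrite -big_filter (perm_big (codom tau)) /=.
  rewrite big_map big_enum /=; apply: eq_bigr => i _.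
  by rewrite /F w_tau p_tau.
apply: uniq_perm => [||k]; first by rewrite filter_uniq // iota_uniq.
  by rewrite map_inj_uniq // enum_uniq.
rewrite mem_filter mem_index_iota ltnS andb_idr //.
by case/codomP => i ->; apply: tau_range.
Qed.

(** * The theorem *)

(* The hypothesis eps 1 = 1 of the last conclusion is needed: B does not      *)
(* depend on eps 1.  For m = 1, l = 2, path 0, -1, -2 and                     *)
(* Delta = t^2 + t^-2 - 1, one finds that the Alexander polynomial of A is 1. *)
Theorem theorem2p2 (m : nat) (m_gt0 : (0 < m)%N)
    (Delta : laurent m)
    (Delta_at1 : leval (fun _ : 'I_m => 1 : int) Delta = 1)
    (Delta_sym : Delta = linv Delta)
    (c : {fsfun 'rV[int]_m -> int with 0})
    (c_at0 : c 0 = 0)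
    (DeltaE : Delta =
      \sum_(a <- finsupp c) (c a)%:~R * (lmon a + lmon (- a)) + 1
      - (\sum_(a <- finsupp c) 2 * c a)%:~R)
    (r : nat) (alpha : 'I_r -> 'rV[int]_m)
    (alpha_inj : injective alpha)
    (alpha_supp : forall a : 'rV[int]_m, c a <> 0 <-> exists i, alpha i = a)
    (l : nat) (l_gt0 : (0 < l)%N)
    (p : nat -> 'rV[int]_m) (eps : nat -> int) (s : nat -> 'I_m)
    (p_at0 : p 0%N = 0)
    (eps_sign : forall t : nat, (1 <= t <= l)%N -> eps t = 1 \/ eps t = -1)
    (p_step : forall t : nat, (1 <= t <= l)%N ->
      p t = p t.-1 + eps t *: delta_mx 0 (s t))
    (tau : 'I_r -> nat)
    (tau_range : forall i : 'I_r, (1 <= tau i <= l)%N)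
    (p_tau : forall i : 'I_r, p (tau i) = alpha i)
    (w v : nat -> int)
    (w_tau : forall i : 'I_r, w (tau i) = c (p (tau i)))
    (w_other : forall j : nat, (1 <= j <= l)%N ->
      (forall i : 'I_r, j <> tau i) -> w j = 0)
    (vE : forall i : nat, (1 <= i <= l)%N -> v i = \sum_(i <= j < l.+1) w j)
    (n : 'I_m -> nat) (size_eq : dsize l = (\sum_i n i)%N)
    (pi : 'S_(dsize l)) (pi_pairs : permutes_pairs pi)
    (P := perm_mx pi : 'M[int]_(dsize l))
    (PT : castmx (size_eq, size_eq)
        (map_mx intr P *m Ttilde s l *m map_mx intr (invmx P)) = Tmx n)
    (A := castmx (size_eq, size_eq) (P *m Bmx v eps l *m invmx P)) :
  boundary_link_seifert A /\ (eps 1%N = 1 -> alexander A = Delta).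
Proof.
pose g := relabel size_eq pi.
have g_inj : injective g by apply: relabel_inj.
have AE : A = mxsub g g (Bmx v eps l).
  by rewrite /A /P invmx_perm castmx_conj_perm.
have TE : Tmx n = mxsub g g (Ttilde s l).
  by rewrite -PT /P invmx_perm !map_perm_mx castmx_conj_perm.
(* Comparing the diagonals of the two matrices [T] shows that the coordinates
   of block i come from pairs that belong to steps in direction i. *)
have s_rank i (u : 'I_(n i)) : s (g (tagnat.Rank i u))./2.+1 = i.
  apply: tvar_inj; transitivity (Tmx n (tagnat.Rank i u) (tagnat.Rank i u)).
    by rewrite TE !mxE eqxx.
  transitivity (submxblock (Tmx n) i i u u); first by rewrite [RHS]mxE.
  by rewrite /Tmx submxblock_diag mxE eqxx.
have A_off i j : i != j -> submxblock A i j = (submxblock A j i)^T.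
  move=> ij; apply/matrixP => u u'; rewrite AE !mxE.
  apply: Bmx_sym_off; apply: contraNneq ij => eq_half.
  by rewrite -(s_rank i u) -(s_rank j u') eq_half.
split.
  split=> // i.
  have SE : skew_part A = mxsub g g (skew_part (Bmx v eps l)).
    by rewrite AE; apply/matrixP => a b; rewrite !mxE.
  have S_off j k : j != k -> submxblock (skew_part A) j k = 0.
    by move=> jk; rewrite submxblockB -tr_submxblock (A_off j k) // subrr.
  have S_square : skew_part A *m skew_part A = - 1%:M.
    rewrite SE -mxsub_mul_inj // Bmx_skew_square //.
    by apply/matrixP => a b; rewrite !mxE (inj_eq g_inj).
  have -> : submxblock A i i - (submxblock A i i)^T =
            submxblock (skew_part A) i i by rewrite submxblockB tr_submxblock.
  apply: det_skew_square_oppr1.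
    by rewrite tr_submxblock /skew_part raddfB /= trmxK -submxblockN opprB.
  rewrite submxblock_mul_diag // S_square submxblockN -mxdiagZ.
  by rewrite submxblock_diag.
move=> eps1.
pose x k : laurent m := tvar (s k.+1).
pose q k := lmon (- p k); pose q' k := lmon (p k).
have dir i : (i < l)%N -> p i.+1 = p i + eps i.+1 *: delta_mx 0 (s i.+1).
  by move=> il; rewrite p_step.
have step_up i : (i < l)%N -> eps i.+1 = 1 ->
    q i = x i * q i.+1 /\ q' i.+1 = x i * q' i.
  move=> il e; rewrite /q /q' /x /tvar -!lmonD dir // e scale1r.
  split; last by rewrite [p i + _]addrC.
  by rewrite opprD addrCA subrr addr0.
have step_down i : (i < l)%N -> eps i.+1 = -1 ->
    q i.+1 = x i * q i /\ q' i = x i * q' i.+1.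
  move=> il e; rewrite /q /q' /x /tvar -!lmonD dir // e scaleN1r.
  split; first by rewrite opprB.
  by rewrite addrC subrK.
have detE : \det (Tmx n *m map_mx intr A - map_mx intr A^T) =
    \prod_(i < l) x i *
    (1 - \sum_(k < l) (w k.+1)%:~R * ((1 - q k.+1) * (1 - q' k.+1))).
  rewrite -(det_twist l_gt0 eps1 eps_sign vE _ _ step_up step_down);
    last 2 first.
  - by rewrite /q p_at0 oppr0.
  - by rewrite /q' p_at0.
  rewrite -(det_mxsub (esym size_eq) g_inj) AE TE; congr determinant.
  rewrite trmx_mxsub !map_mxsub -mxsub_mul_inj // /Ttilde mul_diag_mx.
  by apply/matrixP => a b; rewrite !mxE.
(* The block sizes are read off from the coefficient of t_i in the trace of T,
   which relabelling preserves. *)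
have nE i : n i = (\sum_(k < l) (s k.+1 == i)).*2.
  have : (\tr (Tmx n))@_(unit_row i) = (\tr (Ttilde s l))@_(unit_row i).
    by rewrite TE mxtrace_mxsub.
  rewrite /Tmx mxtrace_mxdiag !coef_sum.
  under eq_bigr do rewrite mxtrace_scalar mcoeffMn coef_tvar -mulrnA.
  rewrite (bigD1 i) //= eqxx mul1n [X in _ + X = _]big1 => [|j /negbTE->//].
  under [in RHS]eq_bigr do rewrite !mxE eqxx mulr1n coef_tvar.
  rewrite (sum_half l (fun k => (s k.+1 == i)%:R : int)) -natr_sum addr0.
  by rewrite -mulrnA muln2 => /eqP; rewrite eqr_nat => /eqP.
have prodE : \prod_(i < l) x i = lmon (\row_i ((n i)./2)%:Z).
  rewrite /x /tvar lmon_sum; congr lmon; apply/rowP => i.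
  rewrite summxE mxE nE doubleK -natz natr_sum; apply: eq_bigr => k _.
  by rewrite mxE eqxx eq_sym.
rewrite /alexander detE prodE mulrA -lmonD.
have -> : \row_i - ((n i)./2)%:Z + \row_i ((n i)./2)%:Z = 0 :> 'rV[int]_m.
  by apply/rowP => i; rewrite !mxE addNr.
rewrite -[lmon 0]/(1 : laurent m) mul1r.
have -> : \sum_(k < l) (w k.+1)%:~R * ((1 - q k.+1) * (1 - q' k.+1)) =
    \sum_(a <- finsupp c) (c a)%:~R * ((1 - lmon (- a)) * (1 - lmon a)).
  exact: (sum_path_weights (fun a => (1 - lmon (- a)) * (1 - lmon a))
    alpha_inj alpha_supp tau_range p_tau w_tau w_other).
rewrite DeltaE addrAC addrC (rmorph_sum intr) -sumrB -sumrN.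
congr (1 + _); apply: eq_bigr => a _.
have lmonN : lmon (- a) * lmon a = 1.
  by rewrite -lmonD addNr -[lmon 0]/(1 : laurent m).
rewrite rmorphM /=; move: (lmon a) (lmon (- a)) lmonN => f f' ff'.
have -> : (1 - f') * (1 - f) = 1 - f - f' + f' * f by ring.
by rewrite ff'; ring.
Qed.
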